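(* Let $n\geq 4$. (i) $P(n)$ and $\overline{X}_n$ are subsets of $\mathbb{E}_n$, and $P(n)\cap\overline{X}_n=\emptyset$. (ii) There is a continuous retraction $R:\mathbb{E}_n\setminus P(n)\rightarrow\overline{X}_n$ (a continuous map restricting to the identity on $\overline{X}_n$).
   Context: Cayley-Dickson algebras: $\mathbb{A}_0=\mathbb{R}$ with $\overline{x}=x$, and $\mathbb{A}_{m+1}=\mathbb{A}_m\times\mathbb{A}_m$ with product $(a,b)(x,y)=(ax-\overline{y}b,\;ya+b\overline{x})$ and conjugation $\overline{(x_1,x_2)}=(\overline{x}_1,-x_2)$. $\mathbb{A}_m=\mathbb{R}^{2^m}$ carries the standard inner product and norm; $\perp$ denotes orthogonality or orthogonal complement. $e_0$ is the unit of each algebra. For $m\geq1$, $\widetilde{e}_0:=(0,e_0)\in\mathbb{A}_m$ (the same symbol is used in each $\mathbb{A}_m$), and for $a=(a_1,a_2)\in\mathbb{A}_m$, $\widetilde{a}:=(-a_2,a_1)$. The doubly pure elements are $\widetilde{\mathbb{A}}_m=\{e_0,\widetilde{e}_0\}^\perp\subset\mathbb{A}_m$; it is a complex vector space with $i\cdot a=\widetilde{a}$. The associator is $(x,y,z)=(xy)z-x(yz)$. $\varepsilon:=(\widetilde{e}_0,0)\in\mathbb{A}_{n+1}$ (with $\widetilde{e}_0\in\mathbb{A}_n$), $\mathbb{H}_\varepsilon:=\mathrm{Span}\{e_0,\widetilde{\varepsilon},\varepsilon,\widetilde{e}_0\}\subset\mathbb{A}_{n+1}$, so $\mathbb{H}_\varepsilon^\perp=\widetilde{\mathbb{A}}_n\times\widetilde{\mathbb{A}}_n$.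 Define $$\mathbb{E}_n=\{\alpha\in\mathbb{H}_\varepsilon^\perp:\ (\alpha,\alpha,\varepsilon)=0\},$$ $$P(n)=\{(a,b)\in\widetilde{\mathbb{A}}_n\times\widetilde{\mathbb{A}}_n:\ a\text{ and }b\text{ are }\mathbb{C}\text{-collinear (linearly dependent over }\mathbb{C})\},$$ $$\overline{X}_n=\{(a,b)\in\widetilde{\mathbb{A}}_n\times\widetilde{\mathbb{A}}_n:\ a\neq0,\ b\neq0,\ ab=0\}.$$ *)

(* Defs.v *)
From HB Require Import structures.
From mathcomp Require Import all_boot all_order all_algebra.
From mathcomp Require Import complex.
From mathcomp Require Import all_classical all_reals all_analysis.
Import Order.TTheory GRing.Theory Num.Theory numFieldNormedType.Exports.

Set Implicit Arguments.
Unset Strict Implicit.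
Unset Printing Implicit Defensive.

Local Open Scope classical_set_scope.
Local Open Scope complex_scope.
Local Open Scope ring_scope.

(* The carrier of $\mathbb{A}_m$ is R^(2^m), built by iterated products.  The
   library norm on it is the max norm, which induces the Euclidean topology;
   the Euclidean inner product is [cd_dot] below. *)
Fixpoint CD (R : realType) (m : nat) : normedModType R :=
  match m with
  | 0 => R^o
  | m'.+1 => (CD R m' * CD R m')%type
  end.

Section CayleyDickson.
Variable R : realType.

Fixpoint cd_conj (m : nat) : CD R m -> CD R m :=
  match m with
  | 0 => fun x : CD R 0 => x
  | m'.+1 => fun x : CD R m'.+1 => (cd_conj x.1, - x.2)
  end.

(* (a, b)(x, y) = (a x - conj(y) b, y a + b conj(x)) *)
Fixpoint cd_mul (m : nat) : CD R m -> CD R m -> CD R m :=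
  match m with
  | 0 => fun a x : R => a * x
  | m'.+1 => fun a x : CD R m'.+1 =>
      (cd_mul a.1 x.1 - cd_mul (cd_conj x.2) a.2,
       cd_mul x.2 a.1 + cd_mul a.2 (cd_conj x.1))
  end.

Fixpoint cd_dot (m : nat) : CD R m -> CD R m -> R :=
  match m with
  | 0 => fun x y : R => x * y
  | m'.+1 => fun x y : CD R m'.+1 => cd_dot x.1 y.1 + cd_dot x.2 y.2
  end.

Fixpoint cd_e0 (m : nat) : CD R m :=
  match m with
  | 0 => (1 : R)
  | m'.+1 => (cd_e0 m', 0)
  end.

(* [cd_et0] and [cd_tilde] are meaningful for m >= 1 only; their values at
   m = 0 are arbitrary. *)
Definition cd_et0 (m : nat) : CD R m :=
  match m with
  | 0 => (0 : R)
  | m'.+1 => (0, cd_e0 m')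
  end.

Definition cd_tilde (m : nat) : CD R m -> CD R m :=
  match m with
  | 0 => fun a : CD R 0 => a
  | m'.+1 => fun a : CD R m'.+1 => (- a.2, a.1)
  end.

Definition cd_assoc (m : nat) (x y z : CD R m) : CD R m :=
  cd_mul (cd_mul x y) z - cd_mul x (cd_mul y z).

Definition cd_perp (m : nat) (A : set (CD R m)) : set (CD R m) :=
  [set x | forall y, A y -> cd_dot x y = 0].

Definition doubly_pure (m : nat) : set (CD R m) :=
  cd_perp [set cd_e0 m; cd_et0 m].

(* The complex scalar multiplication determined by i . a = cd_tilde a. *)
Definition cd_cscale (m : nat) (z : R[i]) (a : CD R m) : CD R m :=
  complex.Re z *: a + complex.Im z *: cd_tilde a.

Definition C_collinear (m : nat) (a b : CD R m) : Prop :=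
  exists z w : R[i],
    (z, w) <> (0, 0) /\ cd_cscale z a + cd_cscale w b = 0.

Definition cd_eps (n : nat) : CD R n.+1 := (cd_et0 n, 0).

Definition H_eps (n : nat) : set (CD R n.+1) :=
  [set x | exists p q r s : R,
     x = p *: cd_e0 n.+1 + q *: cd_tilde (cd_eps n)
         + r *: cd_eps n + s *: cd_et0 n.+1].

Definition E_set (n : nat) : set (CD R n.+1) :=
  [set x | cd_perp (@H_eps n) x /\ cd_assoc x x (cd_eps n) = 0].

Definition P_set (n : nat) : set (CD R n.+1) :=
  [set x | [/\ doubly_pure x.1, doubly_pure x.2 & C_collinear x.1 x.2]].

Definition Xbar (n : nat) : set (CD R n.+1) :=
  [set x | [/\ doubly_pure x.1, doubly_pure x.2,
               x.1 <> 0, x.2 <> 0 & cd_mul x.1 x.2 = 0]].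

End CayleyDickson.

Arguments E_set R n : clear implicits.
Arguments P_set R n : clear implicits.
Arguments Xbar R n : clear implicits.

(* Main.v *)
Require Import Defs.
From mathcomp Require Import all_boot all_order all_algebra.
From mathcomp Require Import complex.
From mathcomp Require Import all_classical all_reals all_analysis.
Import Order.TTheory GRing.Theory Num.Theory numFieldNormedType.Exports.

(* For doubly pure a and b, write ab = (c1, c2).  A direct computation gives
   (alpha, alpha, eps) = (0, (conj c2 - c2, c1 - conj c1)) for alpha = (a, b),
   so E_n is the set of pairs whose product lies in C = Span(e0, et0).  The
   coordinates of ab on e0 and et0 are -<a, b> and -<tilde a, b>; hence on E_n
   one has ab = 0 as soon as b is Hermitian-orthogonal to a.  A complex
   Gram-Schmidt step, (a, b) |-> (a, b - proj_a b), is therefore the required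
   retraction, with both components nonzero exactly when a and b are not
   C-collinear. *)

Local Open Scope classical_set_scope.
Local Open Scope ring_scope.

Section CayleyDicksonTheory.
Context {R : realType}.
Implicit Types (m : nat) (k : R).

(** * Bilinearity, conjugation and unit *)

Lemma CD_ext m (x y : CD R m.+1) : x.1 = y.1 -> x.2 = y.2 -> x = y.
Proof. by case: x => ? ?; case: y => ? ? /= -> ->. Qed.

Lemma cd_mul_pair m (a b x y : CD R m) :
  cd_mul (m:=m.+1) (a, b) (x, y) =
  (cd_mul a x - cd_mul (cd_conj y) b, cd_mul y a + cd_mul b (cd_conj x)).
Proof. by []. Qed.

Lemma cd_dot_pair m (a b x y : CD R m) :
  cd_dot (m:=m.+1) (a, b) (x, y) = cd_dot a x + cd_dot b y.
Proof. by []. Qed.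

Lemma cd_conjD m (x y : CD R m) : cd_conj (x + y) = cd_conj x + cd_conj y.
Proof.
elim: m x y => [//|m IH] x y; apply: CD_ext => /=; first exact: IH.
exact: opprD.
Qed.

Lemma cd_conjZ m k (x : CD R m) : cd_conj (k *: x) = k *: cd_conj x.
Proof.
elim: m x => [//|m IH] x; apply: CD_ext => /=; first exact: IH.
by rewrite -scalerN.
Qed.

Lemma cd_conjN m (x : CD R m) : cd_conj (- x) = - cd_conj x.
Proof. by rewrite -scaleN1r cd_conjZ scaleN1r. Qed.

Lemma cd_conj0 m : cd_conj (0 : CD R m) = 0.
Proof. by rewrite -(scale0r 0) cd_conjZ !scale0r. Qed.

Lemma cd_conjB m (x y : CD R m) : cd_conj (x - y) = cd_conj x - cd_conj y.
Proof. by rewrite cd_conjD cd_conjN. Qed.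

Lemma cd_conjK m (x : CD R m) : cd_conj (cd_conj x) = x.
Proof.
elim: m x => [//|m IH] x; apply: CD_ext => /=; first exact: IH.
exact: opprK.
Qed.

Lemma cd_conj_e0 m : cd_conj (cd_e0 R m) = cd_e0 R m.
Proof. by elim: m => [//|m IH]; apply: CD_ext => /=; rewrite ?oppr0. Qed.

(** The doubling formula puts its factors in both orders, so additivity on one side at level [m.+1]
    uses both sides at level [m]; hence the conjunction. The same pattern recurs for scalars and the
    unit. *)
Lemma cd_mulD m (x y z : CD R m) :
  cd_mul (x + y) z = cd_mul x z + cd_mul y z /\
  cd_mul z (x + y) = cd_mul z x + cd_mul z y.
Proof.
elim: m x y z => [|m IH] x y z; first by split; [exact: mulrDl|exact: mulrDr].
have Dl a b c := proj1 (IH a b c); have Dr a b c := proj2 (IH a b c).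
by split; apply: CD_ext => /=; rewrite ?cd_conjD ?Dl ?Dr ?opprD addrACA.
Qed.

Lemma cd_mulDr m (x y z : CD R m) :
  cd_mul z (x + y) = cd_mul z x + cd_mul z y.
Proof. exact: (cd_mulD _ _ _ _).2. Qed.

Lemma cd_mulZ m k (x y : CD R m) :
  cd_mul (k *: x) y = k *: cd_mul x y /\ cd_mul x (k *: y) = k *: cd_mul x y.
Proof.
elim: m x y => [|m IH] x y.
  by split; [exact/esym/mulrA|exact: mulrCA].
have Zl a b := proj1 (IH a b); have Zr a b := proj2 (IH a b).
by split; apply: CD_ext => /=;
  rewrite ?cd_conjZ ?Zl ?Zr ?scalerBr ?scalerDr.
Qed.

Lemma cd_mulZl m k (x y : CD R m) : cd_mul (k *: x) y = k *: cd_mul x y.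
Proof. exact: (cd_mulZ _ _ _ _).1. Qed.

Lemma cd_mulZr m k (x y : CD R m) : cd_mul x (k *: y) = k *: cd_mul x y.
Proof. exact: (cd_mulZ _ _ _ _).2. Qed.

Lemma cd_mulNl m (x y : CD R m) : cd_mul (- x) y = - cd_mul x y.
Proof. by rewrite -scaleN1r cd_mulZl scaleN1r. Qed.

Lemma cd_mulNr m (x y : CD R m) : cd_mul x (- y) = - cd_mul x y.
Proof. by rewrite -scaleN1r cd_mulZr scaleN1r. Qed.

Lemma cd_mul0l m (x : CD R m) : cd_mul 0 x = 0.
Proof. by rewrite -(scale0r 0) cd_mulZl !scale0r. Qed.

Lemma cd_mul0r m (x : CD R m) : cd_mul x 0 = 0.
Proof. by rewrite -(scale0r 0) cd_mulZr !scale0r. Qed.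

Lemma cd_mul_e0 m (x : CD R m) :
  cd_mul (cd_e0 R m) x = x /\ cd_mul x (cd_e0 R m) = x.
Proof.
elim: m x => [|m IH] x; first by split; [exact: mul1r|exact: mulr1].
have el a := proj1 (IH a); have er a := proj2 (IH a).
by split; apply: CD_ext => /=; rewrite ?cd_conj_e0 ?cd_conj0 ?cd_mul0l
  ?cd_mul0r ?el ?er ?subr0 ?addr0 ?add0r.
Qed.

Lemma cd_conjM m (x y : CD R m) :
  cd_conj (cd_mul x y) = cd_mul (cd_conj y) (cd_conj x).
Proof.
elim: m x y => [|m IH] x y; first exact: mulrC.
apply: CD_ext => /=.
  by rewrite cd_conjB !IH !cd_conjN cd_conjK cd_mulNl cd_mulNr opprK.
by rewrite cd_conjK cd_mulNl cd_mulNl opprD addrC.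
Qed.

(** * The inner product, real parts and norms *)

Lemma cd_dotDl m (x y z : CD R m) :
  cd_dot (x + y) z = cd_dot x z + cd_dot y z.
Proof.
elim: m x y z => [|m IH] x y z /=; first exact: mulrDl.
by rewrite !IH addrACA.
Qed.

Lemma cd_dotZl m k (x y : CD R m) : cd_dot (k *: x) y = k * cd_dot x y.
Proof.
elim: m x y => [|m IH] x y /=; first exact/esym/mulrA.
by rewrite !IH mulrDr.
Qed.

Lemma cd_dotC m (x y : CD R m) : cd_dot x y = cd_dot y x.
Proof. by elim: m x y => [|m IH] x y /=; [exact: mulrC|congr (_ + _)]. Qed.

Lemma cd_dotNl m (x y : CD R m) : cd_dot (- x) y = - cd_dot x y.
Proof. by rewrite -scaleN1r cd_dotZl mulN1r. Qed.

Lemma cd_dot0l m (x : CD R m) : cd_dot 0 x = 0.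
Proof. by rewrite -(scale0r 0) cd_dotZl mul0r. Qed.

Lemma cd_dotDr m (x y z : CD R m) :
  cd_dot x (y + z) = cd_dot x y + cd_dot x z.
Proof. by rewrite !(cd_dotC _ x) cd_dotDl. Qed.

Lemma cd_dotZr m k (x y : CD R m) : cd_dot x (k *: y) = k * cd_dot x y.
Proof. by rewrite !(cd_dotC _ x) cd_dotZl. Qed.

Lemma cd_dotNr m (x y : CD R m) : cd_dot x (- y) = - cd_dot x y.
Proof. by rewrite !(cd_dotC _ x) cd_dotNl. Qed.

Lemma cd_dot0r m (x : CD R m) : cd_dot x 0 = 0.
Proof. by rewrite cd_dotC cd_dot0l. Qed.

Lemma cd_dot_ge0 m (x : CD R m) : 0 <= cd_dot x x.
Proof.
by elim: m x => [|m IH] x /=; [rewrite -expr2 sqr_ge0|rewrite addr_ge0].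
Qed.

Lemma cd_dot_eq0 m (x : CD R m) : cd_dot x x = 0 -> x = 0.
Proof.
elim: m x => [|m IH] x /= /eqP; first by rewrite mulf_eq0 orbb => /eqP.
by rewrite paddr_eq0 ?cd_dot_ge0 // => /andP[/eqP/IH ? /eqP/IH ?];
  apply: CD_ext.
Qed.

Lemma cd_dot_conj m (x y : CD R m) :
  cd_dot (cd_conj x) (cd_conj y) = cd_dot x y.
Proof.
elim: m x y => [//|m IH] x y /=.
by rewrite IH cd_dotNl cd_dotNr opprK.
Qed.

(** Only the first component [x.1 y.1 - conj(y.2) x.2] meets [e0]. By induction its second term
    contributes [- <conj y.2, conj x.2>], and conjugation is an isometry. *)
Lemma cd_dot_mul_e0 m (x y : CD R m) :
  cd_dot (cd_mul x y) (cd_e0 R m) = cd_dot x (cd_conj y).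
Proof.
elim: m x y => [|m IH] x y /=; first by rewrite mulr1.
rewrite cd_dotDl cd_dotNl !IH cd_dot_conj cd_dot0r addr0 cd_dotNr.
by rewrite (cd_dotC _ y.2).
Qed.

Lemma cd_addr_conj m (x : CD R m) :
  x + cd_conj x = (2 * cd_dot x (cd_e0 R m)) *: cd_e0 R m.
Proof.
elim: m x => [|m IH] x /=; first by rewrite mulr1 mulr_natl mulr2n [RHS]mulr1.
apply: CD_ext => /=; first by rewrite IH cd_dot0r addr0.
by rewrite scaler0 subrr.
Qed.

Lemma cd_conj_pure m (x : CD R m) :
  cd_dot x (cd_e0 R m) = 0 -> cd_conj x = - x.
Proof.
move=> x0; apply/eqP; rewrite -addr_eq0 addrC cd_addr_conj.
by rewrite x0 mulr0 scale0r.
Qed.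

Lemma cd_conj_fixP m (x : CD R m) :
  cd_conj x = x <-> x = cd_dot x (cd_e0 R m) *: cd_e0 R m.
Proof.
split=> [xx|->]; last by rewrite cd_conjZ cd_conj_e0.
have := cd_addr_conj _ x; rewrite xx -mulr2n -scaler_nat -scalerA.
by apply: scalerI; rewrite pnatr_eq0.
Qed.

(** The second components cancel by bilinearity. The first component of [x (conj x)] contains
    [conj(x.2) x.2], so the induction needs both orders at once. *)
Lemma cd_mul_conj m (x : CD R m) :
  cd_mul x (cd_conj x) = cd_dot x x *: cd_e0 R m /\
  cd_mul (cd_conj x) x = cd_dot x x *: cd_e0 R m.
Proof.
elim: m x => [|m IH] x; first by split; rewrite /= [RHS]mulr1.
have cl a := proj2 (IH a); have cr a := proj1 (IH a).
split; apply: CD_ext => /=.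
- by rewrite cd_conjN cd_mulNl opprK cr cl scalerDl.
- by rewrite cd_conjK cd_mulNl addNr scaler0.
- by rewrite cd_mulNr opprK !cl scalerDl.
- by rewrite cd_mulNl subrr scaler0.
Qed.

(** * Doubly pure elements and the complex structure [cd_tilde] *)

Lemma doubly_pureP m (a : CD R m.+1) :
  doubly_pure a <->
  cd_dot a.1 (cd_e0 R m) = 0 /\ cd_dot a.2 (cd_e0 R m) = 0.
Proof.
split=> [da|[a1 a2] y /= [->|->] /=].
- split; first by have := da _ (or_introl erefl); rewrite /= cd_dot0r addr0.
  by have := da _ (or_intror erefl); rewrite /= cd_dot0r add0r.
- by rewrite cd_dot0r a1 addr0.
- by rewrite cd_dot0r a2 addr0.
Qed.

Lemma cd_dot_tildel m (a b : CD R m.+1) :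
  cd_dot (cd_tilde a) b = cd_dot a.1 b.2 - cd_dot a.2 b.1.
Proof. by rewrite /= cd_dotNl addrC. Qed.

Lemma cd_tildeK m (a : CD R m.+1) : cd_tilde (cd_tilde a) = - a.
Proof. exact: CD_ext. Qed.

Lemma cd_dot_tilde m (a b : CD R m.+1) :
  cd_dot (cd_tilde a) (cd_tilde b) = cd_dot a b.
Proof. by rewrite /= cd_dotNl cd_dotNr opprK addrC. Qed.

Lemma cd_dot_tilde_self m (a : CD R m.+1) : cd_dot (cd_tilde a) a = 0.
Proof. by rewrite cd_dot_tildel cd_dotC subrr. Qed.

Lemma doubly_pureD m (a b : CD R m.+1) :
  doubly_pure a -> doubly_pure b -> doubly_pure (a + b).
Proof. by move=> da db y Hy; rewrite cd_dotDl da // db // addr0. Qed.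

Lemma doubly_pureZ m k (a : CD R m.+1) : doubly_pure a -> doubly_pure (k *: a).
Proof. by move=> da y Hy; rewrite cd_dotZl da // mulr0. Qed.

Lemma doubly_pure_tilde m (a : CD R m.+1) :
  doubly_pure a -> doubly_pure (cd_tilde a).
Proof.
move=> /doubly_pureP[a1 a2]; apply/doubly_pureP.
by rewrite /= cd_dotNl a2 oppr0.
Qed.

Lemma cd_conj_doubly_pure m (a : CD R m.+1) : doubly_pure a ->
  cd_conj a.1 = - a.1 /\ cd_conj a.2 = - a.2.
Proof. by move=> /doubly_pureP[/cd_conj_pure ? /cd_conj_pure]. Qed.

Lemma cd_sqr_doubly_pure m (a : CD R m.+1) : doubly_pure a ->
  cd_mul a a = - cd_dot a a *: cd_e0 R m.+1.
Proof.
move=> da; have ca : cd_conj a = - a.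
  by apply: cd_conj_pure; apply: da; left.
have := (cd_mul_conj _ a).1; rewrite ca cd_mulNr => /(congr1 -%R).
by rewrite opprK scaleNr.
Qed.

(** Both components of [a] are negated by conjugation: in the first component of the product the two
    terms cancel, and the second becomes the sum of the squares of [a.1] and [a.2]. *)
Lemma cd_mul_tilde_doubly_pure m (a : CD R m.+1) : doubly_pure a ->
  cd_mul a (cd_tilde a) = - cd_dot a a *: cd_et0 R m.+1.
Proof.
move=> /cd_conj_doubly_pure[a1 a2].
have sq (x : CD R m) : cd_conj x = - x ->
    cd_mul x x = - cd_dot x x *: cd_e0 R m.
  by move=> cx; have := (cd_mul_conj _ x).1;
    rewrite cx cd_mulNr scaleNr => <-; rewrite opprK.
apply: CD_ext => /=.
  by rewrite a1 cd_mulNr cd_mulNl opprK addNr scaler0.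
by rewrite cd_conjN a2 opprK !sq // -scalerDl -opprD.
Qed.

(** The coordinate on [et0] is the real part of the second component [b.2 a.1 + a.2 conj(b.1)],
    which is [- <a.1, b.2> + <a.2, b.1>]. *)
Lemma cd_dot_mul_et0 m (a b : CD R m.+1) : doubly_pure a ->
  cd_dot (cd_mul a b) (cd_et0 R m.+1) = - cd_dot (cd_tilde a) b.
Proof.
move=> /cd_conj_doubly_pure[a1 a2].
rewrite /= cd_dot0r add0r cd_dotDl !cd_dot_mul_e0 a1 cd_conjK.
by rewrite cd_dotNr cd_dotNl opprD opprK addrC (cd_dotC _ b.2).
Qed.

Lemma cd_dot_mul_doubly_pure m (a b : CD R m.+1) : doubly_pure b ->
  cd_dot (cd_mul a b) (cd_e0 R m.+1) = - cd_dot a b.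
Proof.
move=> db; rewrite cd_dot_mul_e0 cd_conj_pure ?cd_dotNr //.
by apply: db; left.
Qed.

Lemma cd_mul_et0r m (x : CD R m.+1) : cd_mul x (cd_et0 R m.+1) = cd_tilde x.
Proof.
apply: CD_ext => /=.
  by rewrite cd_mul0r cd_conj_e0 (cd_mul_e0 _ _).1 sub0r.
by rewrite cd_conj0 cd_mul0r addr0 (cd_mul_e0 _ _).1.
Qed.

(** * The associator with [cd_eps] and the equation of E_n *)

Lemma cd_assoc_eps m (a b : CD R m.+1) (alpha : CD R m.+2 := (a, b))
    (c := cd_mul a b) :
  doubly_pure a -> doubly_pure b ->
  cd_assoc alpha alpha (cd_eps R m.+1) =
    (0 : CD R m.+1, (cd_conj c.2 - c.2, c.1 - cd_conj c.1) : CD R m.+1).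
Proof.
move=> da db.
have conj_dp (y : CD R m.+1) : doubly_pure y -> cd_conj y = - y.
  by move=> dy; apply: cd_conj_pure; apply: dy; left.
have conj_et0 : cd_conj (cd_et0 R m.+1) = - cd_et0 R m.+1.
  by apply: CD_ext => /=; rewrite ?cd_conj0 ?oppr0.
have [ca cb] := (conj_dp _ da, conj_dp _ db).
have cta := conj_dp _ (doubly_pure_tilde _ _ da).
have ctb := conj_dp _ (doubly_pure_tilde _ _ db).
(* Conjugation reverses the factors of [b (tilde b)], whose value is known. *)
have ctbb : cd_mul (cd_tilde b) b = cd_dot b b *: cd_et0 R m.+1.
  have := cd_conjM _ b (cd_tilde b).
  rewrite cd_mul_tilde_doubly_pure // cd_conjZ conj_et0 ctb cb.
  by rewrite cd_mulNl cd_mulNr opprK scaleNr scalerN opprK.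
have sq : cd_mul alpha alpha =
    (- (cd_dot a a + cd_dot b b) *: cd_e0 R m.+1, 0 : CD R m.+1).
  rewrite (cd_mul_pair m.+1) ca cb cd_mulNl opprK cd_mulNr subrr.
  by rewrite !cd_sqr_doubly_pure // -scalerDl -opprD.
have ae : cd_mul alpha (cd_eps R m.+1) = (cd_tilde a, - cd_tilde b).
  rewrite (cd_mul_pair m.+1) cd_conj0 !cd_mul0l subr0 add0r conj_et0 cd_mulNr.
  by rewrite !cd_mul_et0r.
rewrite /cd_assoc ae sq !(cd_mul_pair m.+1) cd_conjN ctb opprK cta.
rewrite cd_conj0 !cd_mul0l subr0 addr0 cd_mul_tilde_doubly_pure // ctbb.
rewrite cd_mulZl (cd_mul_e0 _ _).1 !cd_mulNl cd_mulNr.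
rewrite -scaleNr -scalerDl -opprD.
congr (_, _); first exact: subrr.
(* The first components have cancelled and the second one is [u + v]. It is compared with the claim
   component by component, using that conjugation negates the components of [a] and [b]. *)
set u := cd_mul (cd_tilde b) a; set v := cd_mul b (cd_tilde a).
rewrite [LHS]/= sub0r opprD !opprK /u /v.
have [a1 a2] := cd_conj_doubly_pure _ _ da.
have [b1 b2] := cd_conj_doubly_pure _ _ db.
by apply: CD_ext; rewrite /c /= !(cd_conjD, cd_conjN, cd_conjM, a1, a2, b1, b2,
  cd_mulNl, cd_mulNr, opprD, opprK) addrC; congr (_ + _); rewrite addrC.
Qed.

(** The four generators are [(e0, 0)], [(0, et0)], [(et0, 0)] and [(0, e0)], so H_eps is the product
    of two copies of Span(e0, et0). *)
Lemma perp_H_epsP m (a b : CD R m.+1) :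
  cd_perp (@H_eps R m.+1) (a, b) <-> doubly_pure a /\ doubly_pure b.
Proof.
pose x : CD R m.+2 := (a, b).
have eps0 : cd_dot x (cd_eps R m.+1) = cd_dot a (cd_et0 R m.+1).
  by rewrite (cd_dot_pair m.+1) cd_dot0r addr0.
split=> [Hx|[dx1 dx2] _ [p [q [r [s ->]]]]].
  split=> y [->|->].
  - have := Hx (cd_e0 R m.+2).
    rewrite (cd_dot_pair m.+1) !cd_dot0r addr0; apply.
    by exists 1, 0, 0, 0; rewrite scale1r !scale0r !addr0.
  - rewrite -eps0; apply: Hx.
    by exists 0, 0, 1, 0; rewrite scale1r !scale0r !add0r !addr0.
  - have := Hx (cd_et0 R m.+2).
    rewrite (cd_dot_pair m.+1) !cd_dot0r add0r; apply.
    by exists 0, 0, 0, 1; rewrite scale1r !scale0r !add0r.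
  - have := Hx (cd_tilde (cd_eps R m.+1)).
    rewrite (cd_dot_pair m.+1) !cd_dotNr !cd_dot0r oppr0 !add0r; apply.
    by exists 0, 1, 0, 0; rewrite scale1r !scale0r !add0r !addr0.
rewrite !cd_dotDr !cd_dotZr eps0 !(cd_dot_pair m.+1).
rewrite !cd_dotNr !cd_dot0r oppr0 !add0r addr0.
rewrite (dx1 _ (or_introl erefl)) (dx1 _ (or_intror erefl)).
rewrite (dx2 _ (or_introl erefl)) (dx2 _ (or_intror erefl)).
by rewrite !mulr0 !addr0.
Qed.

(** The associator vanishes exactly when both components of [ab] are fixed by conjugation, hence are
    real multiples of [e0]. The multiples are then forced by the coordinate formulas. *)
Lemma E_setP m (a b : CD R m.+1) : E_set R m.+1 (a, b) <->
  [/\ doubly_pure a, doubly_pure b &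
      cd_mul a b = - cd_dot a b *: cd_e0 R m.+1
                       - cd_dot (cd_tilde a) b *: cd_et0 R m.+1].
Proof.
set c := cd_mul _ _; set z := (X in _ = X).
suff key : doubly_pure a -> doubly_pure b ->
    cd_assoc (m:=m.+2) (a, b) (a, b) (cd_eps R m.+1) = 0 <-> c = z.
  split=> [[/perp_H_epsP[d1 d2] ass]|[d1 d2 cz]].
    by split=> //; apply/key.
  by split; [exact/perp_H_epsP|exact/key].
move=> d1 d2; rewrite cd_assoc_eps // -/c.
(* The components of [z] are the real parts of those of [c], so [c = z] says that [c] has real
   components. *)
have z1 : z.1 = cd_dot c.1 (cd_e0 R m) *: cd_e0 R m.
  have := cd_dot_mul_doubly_pure _ a b d2.
  by rewrite -/c [LHS]/= cd_dot0r addr0 /z => <- /=; rewrite scaler0 subr0.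
have z2 : z.2 = cd_dot c.2 (cd_e0 R m) *: cd_e0 R m.
  have := cd_dot_mul_et0 _ a b d1.
  rewrite -/c [LHS]/= cd_dot0r add0r /z => E /=; rewrite E.
  by rewrite scaler0 sub0r scaleNr.
split=> [[/eqP]|cz].
  rewrite subr_eq0 => /eqP/cd_conj_fixP c2 /eqP.
  rewrite subr_eq0 eq_sym => /eqP/cd_conj_fixP c1.
  by apply: CD_ext; rewrite ?z1 ?z2.
have /cd_conj_fixP -> : c.1 = cd_dot c.1 (cd_e0 R m) *: cd_e0 R m
  by rewrite -z1 cz.
have /cd_conj_fixP -> : c.2 = cd_dot c.2 (cd_e0 R m) *: cd_e0 R m
  by rewrite -z2 cz.
by rewrite !subrr.
Qed.

(** * Complex scalars, collinearity and limits of inner products *)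

Lemma cd_tildeD m (a b : CD R m.+1) :
  cd_tilde (a + b) = cd_tilde a + cd_tilde b.
Proof. by apply: CD_ext => //=; exact: opprD. Qed.

Lemma cd_tildeZ m k (a : CD R m.+1) : cd_tilde (k *: a) = k *: cd_tilde a.
Proof. by apply: CD_ext => //=; rewrite scalerN. Qed.

Lemma cd_cscaleA m (z w : complex R) (a : CD R m.+1) :
  cd_cscale z (cd_cscale w a) = cd_cscale (z * w) a.
Proof.
have [eRe eIm] : complex.Re (z * w) =
      complex.Re z * complex.Re w - complex.Im z * complex.Im w /\
    complex.Im (z * w) =
      complex.Re z * complex.Im w + complex.Im z * complex.Re w.
  by case: z w => [? ?] [].
rewrite /cd_cscale eRe eIm cd_tildeD !cd_tildeZ cd_tildeK !scalerDr !scalerA.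
by rewrite scalerN scalerBl scalerDl (addrC (_ *: cd_tilde a)) addrACA.
Qed.

Lemma cd_cscale1 m (a : CD R m.+1) : cd_cscale 1 a = a.
Proof. by rewrite /cd_cscale scale1r scale0r addr0. Qed.

Lemma cd_cscale0 m (z : complex R) : cd_cscale z (0 : CD R m.+1) = 0.
Proof.
by rewrite /cd_cscale -(scale0r 0) cd_tildeZ !scale0r !scaler0 addr0.
Qed.

Lemma cd_cscale0l m (a : CD R m.+1) : cd_cscale 0 a = 0.
Proof. by rewrite /cd_cscale !scale0r addr0. Qed.

Lemma cd_cscaleN m (z : complex R) (a : CD R m.+1) :
  cd_cscale (- z) a = - cd_cscale z a.
Proof. by case: z => p q; rewrite /cd_cscale /= !scaleNr opprD. Qed.

(** Division by the coefficient of [b], or by that of [a] when the former is zero. In this form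
    collinearity can be compared with the projection onto the complex line of [a]. *)
Lemma C_collinearP m (a b : CD R m.+1) :
  C_collinear a b <-> a = 0 \/ exists z, b = cd_cscale z a.
Proof.
split=> [[z [w [nzw zw]]]|[->|[z ->]]]; last 2 first.
- exists 1, 0; split; first by case=> /eqP; rewrite oner_eq0.
  by rewrite cd_cscale0 cd_cscale0l addr0.
- exists (- z), 1; split; first by case=> _ /eqP; rewrite oner_eq0.
  by rewrite cd_cscale1 cd_cscaleN addNr.
have [w0|w0] := eqVneq w 0; [left|right].
  have z0 : z != 0 by apply/eqP => z0; apply: nzw; rewrite z0 w0.
  move: zw; rewrite w0 cd_cscale0l addr0 => /(congr1 (cd_cscale z^-1)).
  by rewrite cd_cscaleA mulVf // cd_cscale1 cd_cscale0.
exists (w^-1 * - z); rewrite -cd_cscaleA cd_cscaleN.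
move/eqP: zw; rewrite addrC addr_eq0 => /eqP <-.
by rewrite cd_cscaleA mulVf // cd_cscale1.
Qed.

(** Arbitrary maps along a filter let the induction pass to the components [f.1], [f.2], [g.1],
    [g.2]. *)
Lemma cvg_cd_dot (T : Type) (F : set_system T) (FF : Filter F) m
    (f g : T -> CD R m) (a b : CD R m) :
  f @ F --> a -> g @ F --> b ->
  (fun t => cd_dot (f t) (g t) : R) @ F --> (cd_dot a b : R).
Proof.
elim: m f g a b => [|m IH] f g a b fa gb; first exact: cvgM.
apply: cvgD; apply: IH.
- exact: (cvg_comp _ _ fa (@cvg_fst _ _ _ _ _)).
- exact: (cvg_comp _ _ gb (@cvg_fst _ _ _ _ _)).
- exact: (cvg_comp _ _ fa (@cvg_snd _ _ _ _ _)).
- exact: (cvg_comp _ _ gb (@cvg_snd _ _ _ _ _)).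
Qed.

(** * Complex lines, projection and the sets P and Xbar *)

Lemma cd_tilde0 m : cd_tilde (0 : CD R m.+1) = 0.
Proof. by rewrite -(scale0r 0) cd_tildeZ !scale0r. Qed.

Lemma doubly_pure_cscale m (z : complex R) (a : CD R m.+1) :
  doubly_pure a -> doubly_pure (cd_cscale z a).
Proof.
by move=> da; apply: doubly_pureD; apply: doubly_pureZ;
  last exact: doubly_pure_tilde.
Qed.

(** The products of [a] with [a] and with [tilde a] are multiples of [e0] and [et0]. This serves
    both for collinear pairs and for subtracting a projection. *)
Lemma cd_mul_cscale m (z : complex R) (a : CD R m.+1) : doubly_pure a ->
  cd_mul a (cd_cscale z a) = - (complex.Re z * cd_dot a a) *: cd_e0 R m.+1
                             - (complex.Im z * cd_dot a a) *: cd_et0 R m.+1.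
Proof.
move=> da; rewrite cd_mulDr !cd_mulZr cd_sqr_doubly_pure //.
by rewrite cd_mul_tilde_doubly_pure // !scalerA !mulrN (scaleNr _ (cd_et0 _ _)).
Qed.

Lemma cd_dot_cscale m (z : complex R) (a : CD R m.+1) :
  cd_dot a (cd_cscale z a) = complex.Re z * cd_dot a a.
Proof.
by rewrite cd_dotDr !cd_dotZr (cd_dotC _ a (cd_tilde a)) cd_dot_tilde_self
  mulr0 addr0.
Qed.

Lemma cd_dot_tilde_cscale m (z : complex R) (a : CD R m.+1) :
  cd_dot (cd_tilde a) (cd_cscale z a) = complex.Im z * cd_dot a a.
Proof.
by rewrite cd_dotDr !cd_dotZr cd_dot_tilde_self cd_dot_tilde mulr0 add0r.
Qed.

(** The Hermitian projection of [b] onto the complex line of [a]; for real scalars, [a] and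
    [tilde a] are orthogonal of equal norm. At [a = 0] it is 0. *)
Definition cd_proj m (a b : CD R m) : CD R m :=
  cd_cscale (Complex (cd_dot a b / cd_dot a a)
                     (cd_dot (cd_tilde a) b / cd_dot a a)) a.

Lemma cd_dot_neq0 m (a : CD R m) : a <> 0 -> cd_dot a a != 0.
Proof. by move=> a0; apply/eqP => /cd_dot_eq0. Qed.

(** On E_n, [ab] and [a (cd_proj a b)] have the same coordinates on [e0] and [et0], and no
    others. *)
Lemma cd_mul_sub_proj m (a b : CD R m.+1) :
  E_set R m.+1 (a, b) -> a <> 0 -> cd_mul a (b - cd_proj _ a b) = 0.
Proof.
move=> /E_setP[da db ab] a0.
rewrite cd_mulDr cd_mulNr cd_mul_cscale // ab.
by rewrite !divfK ?subrr //; exact: cd_dot_neq0.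
Qed.

(** If [ab = 0], both its coordinates vanish, so [b] is orthogonal to [a] and to [tilde a]. The
    vanishing projection is what makes the retraction fix Xbar. *)
Lemma Xbar_E m (a b : CD R m.+1) :
  Xbar R m.+1 (a, b) -> E_set R m.+1 (a, b) /\ cd_proj _ a b = 0.
Proof.
move=> [da db _ _ ab0]; have ab : cd_mul a b = 0 := ab0.
have dab : cd_dot a b = 0.
  by apply: oppr_inj; rewrite oppr0 -cd_dot_mul_doubly_pure // ab cd_dot0l.
have dtab : cd_dot (cd_tilde a) b = 0.
  by apply: oppr_inj; rewrite oppr0 -cd_dot_mul_et0 // ab cd_dot0l.
split.
  by apply/E_setP; split; rewrite // dab dtab ab oppr0 !scale0r subrr.
by rewrite /cd_proj dab dtab !mul0r cd_cscale0l.
Qed.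

Lemma P_sub_E m (a b : CD R m.+1) : P_set R m.+1 (a, b) -> E_set R m.+1 (a, b).
Proof.
move=> [da db col]; have /C_collinearP ab : C_collinear a b := col.
apply/E_setP; split=> //.
case: ab => [->|[z ->]].
  by rewrite cd_tilde0 !cd_dot0l cd_mul0l oppr0 !scale0r subrr.
by rewrite cd_mul_cscale // cd_dot_cscale cd_dot_tilde_cscale.
Qed.

(** A vector on the complex line of [a] is its own projection, while on Xbar the projection is 0;
    this contradicts [b <> 0]. *)
Lemma P_disjoint_Xbar m (a b : CD R m.+1) :
  P_set R m.+1 (a, b) -> ~ Xbar R m.+1 (a, b).
Proof.
move=> [_ _ col] X; have [_ _ a0 b0 _] := X.
have /C_collinearP[//|[z bz]] : C_collinear a b := col.
have [_] := Xbar_E _ _ _ X.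
rewrite /cd_proj {1 2}bz cd_dot_cscale cd_dot_tilde_cscale.
rewrite !mulfK ?cd_dot_neq0 //.
by case: z bz => p q <-.
Qed.

Lemma Xbar_sub_proj m (a b : CD R m.+1) :
  E_set R m.+1 (a, b) -> ~ P_set R m.+1 (a, b) ->
  Xbar R m.+1 (a, b - cd_proj _ a b).
Proof.
move=> Eab nP; have /E_setP[da db _] := Eab.
have ncol : ~ C_collinear a b by move=> ?; apply: nP.
have a0 : a <> 0 by move=> a0; apply/ncol/C_collinearP; left.
split=> //=; last exact: cd_mul_sub_proj.
  apply: doubly_pureD => //; rewrite -scaleN1r.
  by apply/doubly_pureZ/doubly_pure_cscale.
move=> /eqP; rewrite subr_eq0 => /eqP b_proj.
by apply/ncol/C_collinearP; right; eexists; exact: b_proj.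
Qed.

(** * Continuity of the projection and the conclusion *)

Lemma cvg_cd_proj (T : Type) (F : set_system T) (FF : Filter F) m
    (f g : T -> CD R m.+1) (a b : CD R m.+1) : a <> 0 ->
  f @ F --> a -> g @ F --> b ->
  (fun t => cd_proj _ (f t) (g t)) @ F --> cd_proj _ a b.
Proof.
move=> /cd_dot_neq0 a0 fa gb.
have tfa : (fun t => cd_tilde (f t)) @ F --> cd_tilde a.
  apply: cvg_pair => /=.
    apply: cvgN; exact: (cvg_comp _ _ fa (@cvg_snd _ _ _ _ _)).
  exact: (cvg_comp _ _ fa (@cvg_fst _ _ _ _ _)).
(* The denominator [<f t, f t>] has the nonzero limit [<a, a>], so inversion passes to the limit. *)
by apply: cvgD; apply: cvgZ => //; apply: cvgM;
  try apply: cvgV => //; exact: cvg_cd_dot.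
Qed.

Lemma cvg_sub_proj (T : Type) (F : set_system T) (FF : Filter F) m
    (f g : T -> CD R m.+1) (a b : CD R m.+1) : a <> 0 ->
  f @ F --> a -> g @ F --> b ->
  (fun t => (f t, g t - cd_proj _ (f t) (g t)) : CD R m.+2) @ F -->
    ((a, b - cd_proj _ a b) : CD R m.+2).
Proof.
move=> a0 fa gb.
have gp : (fun t => g t - cd_proj _ (f t) (g t)) @ F --> b - cd_proj _ a b.
  by apply: cvgB => //; exact: cvg_cd_proj.
exact: cvg_pair fa gp.
Qed.

End CayleyDicksonTheory.

Theorem theorem4p5 (R : realType) (n : nat) (hn : (4 <= n)%N) :
  [/\ P_set R n `<=` E_set R n,
      Xbar R n `<=` E_set R n &
      P_set R n `&` Xbar R n = set0] /\
  (exists r : CD R n.+1 -> CD R n.+1,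
     [/\ {within E_set R n `\` P_set R n, continuous r},
         r @` (E_set R n `\` P_set R n) `<=` Xbar R n &
         forall x, Xbar R n x -> r x = x]).
Proof.
case: n hn => [//|m] _; split.
  split.
  - by move=> [a b]; exact: P_sub_E.
  - by move=> [a b] /Xbar_E[].
  - by rewrite -subset0 => -[a b] [Pab Xab]; apply: P_disjoint_Xbar Xab.
exists (fun x => (x.1, x.2 - cd_proj m.+1 x.1 x.2)); split.
- apply: continuous_in_subspaceT => -[a b] /set_mem [Eab nP].
  (* The first component is unchanged by the map, so membership of the image in Xbar yields
     [a <> 0]; continuity then holds at the point in the ambient space. *)
  have [_ _ a0 _ _] := Xbar_sub_proj _ _ _ Eab nP.
  apply: (cvg_sub_proj _ _ _ _ fst snd); [by []|exact: cvg_fst|exact: cvg_snd].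
- by move=> _ [[a b] [Eab nP] <-]; exact: Xbar_sub_proj.
- by move=> [a b] /Xbar_E[_ /= ->]; rewrite subr0.
Qed.
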